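(* Let $A$ be a finite alphabet, let $F\colon A^{\mathbb{Z}}\to A^{\mathbb{Z}}$ be a cellular automaton and let $\mu$ be a Borel probability measure on $A^{\mathbb{Z}}$ that is $F$-invariant and shift-ergodic. If $F$ has some $\mu$-equicontinuous points, then the set of $F$-periodic points is dense in the topological support $S(\mu)$ of $\mu$.
   Context: $A^{\mathbb{Z}}$ carries the product topology of the discrete topology on the finite set $A$. The shift is $\sigma(x)=(x_{i+1})_{i\in\mathbb{Z}}$. A cellular automaton is a continuous map $F\colon A^{\mathbb{Z}}\to A^{\mathbb{Z}}$ commuting with $\sigma$. A measure is shift-ergodic if it is $\sigma$-invariant and ergodic for $\sigma$. It is $F$-invariant if $\mu\circ F^{-1}=\mu$. The topological support $S(\mu)$ is the smallest closed set of $\mu$-measure $1$. A point $w$ is $F$-periodic if $F^m(w)=w$ for some $m\ge 1$. For $n\in\mathbb{N}$ ($\mathbb{N}$ contains $0$) and $x\in A^{\mathbb{Z}}$ put $C_n(x)=\{y: y_j=x_j \text{ for } -n\le j\le n\}$ and $B_n(x)=\{y: F^i(y)_j=F^i(x)_j \text{ for all } i\in\mathbb{N} \text{ and } -n\le j\le n\}$. A point $x$ is $\mu$-equicontinuous (also called $\mu$-almost equicontinuous) for $F$ if for all $m\in\mathbb{N}$, $\lim_{n\to\infty}\mu(C_n(x)\cap B_m(x))/\mu(C_n(x))=1$ (in particular $\mu(C_n(x))>0$ for all $n$). *)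

(* Defs.v *)
From HB Require Import structures.
From mathcomp Require Import all_boot all_order all_algebra.
From mathcomp Require Import all_classical all_reals all_analysis.

Set Implicit Arguments.
Unset Strict Implicit.
Unset Printing Implicit Defensive.

Import Order.TTheory GRing.Theory Num.Theory.
Import numFieldNormedType.Exports.

Local Open Scope classical_set_scope.
Local Open Scope ring_scope.

(* Measurable types are pointed in the library, hence the pointed alphabet;
   this only excludes the empty alphabet, over which there is no configuration
   and hence no probability. *)
Definition config (A : pointedType) : Type :=
  prod_topology (fun _ : int => discrete_topology A).

HB.instance Definition _ (A : pointedType) := Pointed.on (config A).
HB.instance Definition _ (A : pointedType) := Uniform.on (config A).
HB.instance Definition _ (R : realType) (A : pointedType) :=
  PseudoMetric.copy (config A)
    (prod_topology (fun _ : int => discrete_topology A : pseudoMetricType R)).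

Definition borel_config (A : pointedType) : Type :=
  g_sigma_algebraType (@open (config A)).

HB.instance Definition _ (A : pointedType) := Measurable.on (borel_config A).

Definition shift (A : pointedType) (x : config A) : config A :=
  fun i : int => x (i + 1).

Definition cellular_automaton (A : pointedType) (F : config A -> config A) :=
  continuous F /\ F \o @shift A = @shift A \o F.

Section measures.
Context {A : pointedType} {R : realType}.
Implicit Types (mu : probability (borel_config A) R) (F : config A -> config A).

Definition invariant_measure mu F :=
  forall E : set (borel_config A), measurable E -> mu (F @^-1` E) = mu E.

Definition shift_ergodic mu :=
  invariant_measure mu (@shift A) /\
  forall E : set (borel_config A), measurable E ->
    @shift A @^-1` E = E -> mu E = 0%E \/ mu E = 1%E.

(* This is the smallest closed set of measure 1: see topological_supportP. *)
Definition topological_support mu : set (config A) :=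
  \bigcap_(C in [set C : set (config A) | closed C /\ mu C = 1%E]) C.

Definition cylinder (n : nat) (x : config A) : set (config A) :=
  [set y | forall j : int, - n%:Z <= j <= n%:Z -> y j = x j].

Definition trace_class F (n : nat) (x : config A) : set (config A) :=
  [set y | forall (i : nat) (j : int), - n%:Z <= j <= n%:Z ->
     iter i F y j = iter i F x j].

Definition mu_equicontinuous mu F (x : config A) :=
  (forall n : nat, (0 < mu (cylinder n x))%E) /\
  forall m : nat,
    fine (mu (cylinder n x `&` trace_class F m x)) / fine (mu (cylinder n x))
      @[n --> \oo] --> (1 : R).

End measures.

Definition periodic_points (T : Type) (F : T -> T) : set T :=
  [set w | exists m : nat, (1 <= m)%N /\ iter m F w = w].

(* D need not be contained in S. *)
Definition dense_in (T : topologicalType) (D S : set T) := S `<=` closure D.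

Lemma config_second_countable (R : realType) (A : pointedType) :
  finite_set [set: A] -> @second_countable (config A).
Proof.
move=> finA; have cptA : compact [set: discrete_topology A].
  exact: finite_compact.
have cptC : compact [set: config A].
  have := @tychonoff int (fun=> discrete_topology A) (fun=> setT) (fun=> cptA).
  by congr (compact _); rewrite eqEsubset.
exact: (@compact_second_countable R (config A)).
Qed.

Lemma topological_supportP (A : pointedType) (R : realType)
    (mu : probability (borel_config A) R) : finite_set [set: A] ->
  [/\ closed (topological_support mu), mu (topological_support mu) = 1%E &
      forall C : set (config A), closed C -> mu C = 1%E ->
        topological_support mu `<=` C].
Proof.
move=> finA.
have open_mE (U : set (config A)) :
    open U -> measurable (U : set (borel_config A)).
  by move=> oU; exact: sub_sigma_algebra.
have closed_mE (C : set (config A)) :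
    closed C -> measurable (C : set (borel_config A)).
  by move=> /closed_openC/open_mE/measurableC; rewrite setCK.
have clS : closed (topological_support mu) by apply: closed_bigI => C [].
split=> //; last by move=> C cC mC x; apply.
pose S : set (borel_config A) := topological_support mu.
have mS : measurable S by exact: closed_mE.
suff S0 : mu.-negligible (~` S).
  have := probability_setC mu (measurableC mS).
  by rewrite setCK (measure_negligible (measurableC mS) S0) sube0.
have [B cB [oB nB]] := config_second_countable R finA.
pose N : set (set (borel_config A)) := [set U | B U /\ mu U = 0%E].
have cN : countable N by apply: sub_countable cB; apply: subset_card_le => U [].
have sN : ~` S `<=` \bigcup_(U in N) U.
  move=> x /existsNP[C /not_implyP[[cC mC] nCx]].
  have [] := nB x (~` C).
    by apply: open_nbhs_nbhs; split => //; exact: closed_openC.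
  move=> U [BU Ux] UC; exists U => //; split=> //.
  have mC' : measurable (C : set (borel_config A)) by exact: closed_mE.
  have C0 : mu (~` (C : set (borel_config A))) = 0%E.
    by rewrite probability_setC// mC subee.
  apply/eqP; rewrite -measure_le0 -C0.
  apply: (@le_measure _ _ _ mu) => //; rewrite inE; last exact: measurableC.
  exact: (open_mE _ (oB _ BU)).
apply: (negligibleS sN).
have [->|[f]] : N = set0 \/ $|{surjfun [set: nat] >-> N}| by exact/pfcard_geP.
  by rewrite bigcup_set0; exact: negligible_set0.
apply: (@negligibleS _ _ _ mu (\bigcup_k f k)).
  by move=> x [U /(@surj _ _ _ _ f)[k _ <-] Ux]; exists k.
apply: negligible_bigcup => k; have [Bf f0] : N (f k) by exact: funS.
have mf : measurable (f k : set (borel_config A)) := open_mE _ (oB _ Bf).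
exact/(negligibleP mu mf).
Qed.

(* Main.v *)
Require Import Defs.
From mathcomp Require Import all_boot all_order all_algebra.
From mathcomp Require Import all_classical all_reals all_analysis.
From mathcomp Require Import zify ring.

(* Let B be the set of configurations with the same trace as the equicontinuous
   point on [-r, r], r being the radius of F; then mu B > 0. By ergodicity of
   the shift applied twice, the points y such that y is in B, sigma^a y is in a
   given cylinder of positive measure and sigma^b y is in B, with a and then b
   large, have positive measure. By Poincare recurrence for F, some such y
   satisfies F^k y = y on [0, b[ with k > 0. The two walls of y at 0 and b have
   the same trace, so F^t maps the b-periodic configuration w repeating
   y_0 ... y_(b-1) to the one repeating the word of F^t y on [0, b[; hence
   F^k w = w, and sigma^a w is an F-periodic point of the cylinder. *)

Set Implicit Arguments.
Unset Strict Implicit.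
Unset Printing Implicit Defensive.

Import Order.TTheory GRing.Theory Num.Theory.

Local Open Scope classical_set_scope.
Local Open Scope ring_scope.

(** * Recurrence and ergodicity for maps preserving a probability measure *)

Section recurrence.
Context d (T : measurableType d) (R : realType) (mu : probability T R).
Variable f : T -> T.
Hypothesis mf : measurable_fun [set: T] f.
Hypothesis invf : forall E, measurable E -> mu (f @^-1` E) = mu E.

(** Decreasing in [N]; the intersection over all [N] is the limsup set, which is strictly
    [f]-invariant, as [ergf] demands. *)
Definition visits (E : set T) (N : nat) : set T :=
  \bigcup_j (iter (N + j) f @^-1` E).

Lemma measurable_preimage_iter (E : set T) n :
  measurable E -> measurable (iter n f @^-1` E).
Proof.
move=> mE; elim: n => [//|n IHn].
have -> : iter n.+1 f @^-1` E = f @^-1` (iter n f @^-1` E).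
  by rewrite predeqE => x /=; rewrite -iterSr.
by rewrite -[_ @^-1` _]setTI; exact: mf.
Qed.

Lemma measurable_visits (E : set T) N : measurable E -> measurable (visits E N).
Proof.
by move=> mE; apply: bigcupT_measurable => j; exact: measurable_preimage_iter.
Qed.

Lemma preimage_visits (E : set T) N : f @^-1` (visits E N) = visits E N.+1.
Proof.
by rewrite predeqE => x; split=> -[j _ /= Ej]; exists j => //=;
  move: Ej; rewrite -iterSr.
Qed.

Lemma visitsS (E : set T) N : visits E N.+1 `<=` visits E N.
Proof. by move=> x [j _ Ej]; exists j.+1 => //=; rewrite addnS. Qed.

Lemma visits_sub0 (E : set T) N : visits E N `<=` visits E 0.
Proof. by elim: N => // N; apply: subset_trans; exact: visitsS. Qed.

(** By invariance the nested sets [visits E N] all have the same finite measure. *)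
Lemma negligible_visitsD (E : set T) N :
  measurable E -> mu.-negligible (visits E 0 `\` visits E N).
Proof.
move=> mE; have mV n := measurable_visits n mE.
have VN : mu (visits E N) = mu (visits E 0).
  by elim: N => // N IHN; rewrite -preimage_visits invf.
apply/negligibleP; first exact: measurableD.
rewrite measureD//; last by rewrite (le_lt_trans (probability_le1 mu _)) ?ltry.
have -> : visits E 0 `&` visits E N = visits E N by apply/setIidPr; exact: visits_sub0.
by rewrite [X in (_ - X)%E]VN subee// fin_num_measure.
Qed.

(** The points of [E] that never return are in [visits E 0] but not in [visits E 1], hence in a null
    set. *)
Lemma poincare_recurrence (E : set T) : measurable E -> (0 < mu E)%E ->
  exists2 x, E x & exists k, E (iter k.+1 f x).
Proof.
move=> mE E0; apply: contrapT => nret; move: E0.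
rewrite lt_neqAle => /andP[/eqP + _]; apply; apply/esym/(negligibleP mu mE).
apply: negligibleS (negligible_visitsD 1 mE) => x Ex; split.
  by exists 0.
by move=> [k _ Ek]; apply: nret; exists x => //; exists k.
Qed.

Hypothesis ergf : forall E, measurable E -> f @^-1` E = E ->
  mu E = 0%E \/ mu E = 1%E.

(** The set [L] of points visiting [E] infinitely often is invariant, hence null or full. It
    contains almost all of [E], so it is not null. If it is full, almost every point of [V] meets
    [E] after time [N], and one of these countably many times has positive measure. *)
Lemma ergodic_hits (V E : set T) N : measurable V -> measurable E ->
  (0 < mu V)%E -> (0 < mu E)%E ->
  exists2 j, (N <= j)%N & (0 < mu (V `&` iter j f @^-1` E))%E.
Proof.
move=> mV mE V0 E0; pose L := \bigcap_n visits E n.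
have mVis n := measurable_visits n mE.
have mL : measurable L by exact: bigcapT_measurable.
have fL : f @^-1` L = L.
  rewrite preimage_bigcap predeqE => x; split=> Lx n _.
    by apply: visitsS; rewrite -preimage_visits; exact: Lx.
  by rewrite preimage_visits; exact: Lx.
have [/(negligibleP mu mL) L0|L1] := ergf mL fL.
  suff /(negligibleP mu mE) mE0 : mu.-negligible E by rewrite mE0 ltxx in E0.
  have := negligible_bigcup (fun n => negligible_visitsD n mE).
  move=> /(negligibleU L0); apply: negligibleS => x Ex.
  have [Lx|] := pselect (L x); first by left.
  move=> /existsNP[n /not_implyP[_ nEx]]; right; exists n => //; split=> //.
  by exists 0.
apply: contrapT => nhit; move: V0; rewrite lt_neqAle => /andP[/eqP + _].
apply; apply/esym/(negligibleP mu mV).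
have CL0 : mu.-negligible (~` L).
  have CL : mu (~` L) = 0%E by rewrite probability_setC// L1 subee.
  by apply/negligibleP => //; exact: measurableC.
have Vj0 j : mu.-negligible (V `&` iter (N + j) f @^-1` E).
  have mj : measurable (V `&` iter (N + j) f @^-1` E).
    by apply: measurableI => //; exact: measurable_preimage_iter.
  apply/negligibleP => //; apply/eqP; rewrite eq_le measure_ge0 andbT leNgt.
  by apply/negP => hj; apply: nhit; exists (N + j)%N; rewrite ?leq_addr.
apply: negligibleS (negligibleU CL0 (negligible_bigcup Vj0)) => x Vx.
have [Lx|] := pselect (L x); last by left.
by have [j _ Ej] := Lx N I; right; exists j.
Qed.

End recurrence.

(** Otherwise [E] would be a countable union of null sets. *)
Lemma positive_fiber d (T : measurableType d) (R : realType)
    (mu : probability T R) (I : choiceType) (g : T -> I) (E : set T) :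
  countable [set: I] -> measurable E ->
  (forall i, measurable (g @^-1` [set i])) -> (0 < mu E)%E ->
  exists i, (0 < mu (E `&` g @^-1` [set i]))%E.
Proof.
move=> /countable_injP[h hI] mE mg E0; apply: contrapT => nfib; move: E0.
rewrite lt_neqAle => /andP[/eqP + _]; apply; apply/esym/(negligibleP mu mE).
(* The injection [h] numbers the fibers; a number that is not attained gives the empty set. *)
have Ek0 k : mu.-negligible (\bigcup_(i in [set i | h i = k]) (E `&` g @^-1` [set i])).
  have [[i hi]|nk] := pselect (exists i, h i = k); last first.
    apply: negligibleS (negligible_set0 mu) => x [i hi _].
    by apply: nk; exists i.
  have mi : measurable (E `&` g @^-1` [set i]) by exact: measurableI.
  suff : mu.-negligible (E `&` g @^-1` [set i]).
    apply: negligibleS => x [j hj Ej].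
    by rewrite (_ : i = j)//; apply: hI; rewrite ?inE// hi.
  apply/negligibleP => //; apply/eqP; rewrite eq_le measure_ge0 andbT leNgt.
  by apply/negP => hi0; apply: nfib; exists i.
apply: negligibleS (negligible_bigcup Ek0) => x Ex.
by exists (h (g x)) => //; exists (g x).
Qed.

(** * Topology of the configuration space and local rules *)

Section cellular_automata.
Context {A : pointedType}.
Implicit Types (F : config A -> config A) (x y z : config A).

Lemma config_proj_continuous (p : int) :
  continuous (fun x : config A => x p : discrete_topology A).
Proof. exact: (@proj_continuous int (fun=> discrete_topology A)). Qed.

Lemma open_proj (p : int) (B : set A) : open [set x : config A | B (x p)].
Proof.
by move: (@config_proj_continuous p) => /continuousP; apply; exact: discrete_open.
Qed.

Lemma closed_proj (p : int) (B : set A) : closed [set x : config A | B (x p)].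
Proof.
rewrite -[X in closed X]setCK; exact: open_closedC (open_proj _ (~` B)).
Qed.

Lemma cylinderxx n x : cylinder n x x. Proof. by []. Qed.

Lemma cylinder_sub m n x : (m <= n)%N -> cylinder n x `<=` cylinder m x.
Proof. by move=> mn y xy j jm; apply: xy; lia. Qed.

Lemma nbhs_cylinder x (U : set (config A)) :
  nbhs x U -> exists n, cylinder n x `<=` U.
Proof.
move=> xU; pose G := filter_from [set: nat] (fun n => cylinder n x).
have FG : Filter G.
  apply: filter_from_filter; first by exists 0.
  move=> i j _ _; exists (maxn i j) => // y xy.
  by split; apply: cylinder_sub xy; rewrite ?leq_maxl ?leq_maxr.
suff /(_ U xU)[n _ nU] : G --> x by exists n.
apply/cvg_sup => p V [_ [[W oW <-] Wxp] WV].
(* The smallest centered window that contains the coordinate [p]. *)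
exists `|p|%N => // y xy; apply: WV => /=.
by rewrite /= xy//; lia.
Qed.

Lemma open_cylinder n x : open (cylinder n x).
Proof.
elim: n => [|n IHn].
  rewrite (_ : cylinder 0 x = [set y : config A | [set x 0] (y 0)]).
    exact: open_proj.
  rewrite predeqE => y; split=> [xy|/= y0 j j0]; first exact: xy.
  by have -> : j = 0 by lia.
rewrite (_ : cylinder n.+1 x = cylinder n x `&`
    ([set y : config A | [set x n.+1%:Z] (y n.+1%:Z)] `&`
     [set y : config A | [set x (- n.+1%:Z)] (y (- n.+1%:Z))])).
  by apply: openI => //; apply: openI; exact: open_proj.
rewrite predeqE => y; split=> [xy|[xy [/= yr yl]] j jn].
  by split; [apply: cylinder_sub xy|split; apply: xy; lia].
have [->//|jr] := eqVneq j n.+1%:Z; have [->//|jl] := eqVneq j (- n.+1%:Z).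
by apply: xy; lia.
Qed.

Lemma nbhs_cylinderxx n x : nbhs x (cylinder n x).
Proof. by apply: open_nbhs_nbhs; split => //; exact: open_cylinder. Qed.

Lemma closed_cylinder n x : closed (cylinder n x).
Proof.
rewrite (_ : cylinder n x = \bigcap_(j in [set j : int | - n%:Z <= j <= n%:Z])
  [set y : config A | [set x j] (y j)]).
  by apply: closed_bigI => j _; exact: closed_proj.
by rewrite predeqE => y; split=> xy j; [exact: xy|move=> jn; exact: xy].
Qed.

Lemma shift_continuous : continuous (@Defs.shift A).
Proof.
move=> x U /nbhs_cylinder[n nU]; apply: filterS (nbhs_cylinderxx n.+1 x).
by move=> y xy; apply: nU => j jn; rewrite /Defs.shift xy//; lia.
Qed.

Lemma iter_shiftE n x (p : int) : iter n (@Defs.shift A) x p = x (p + n%:Z).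
Proof.
elim: n p => [|n IHn] p /=; first by rewrite addr0.
by rewrite /Defs.shift IHn; congr x; lia.
Qed.


Lemma iter_shift_commute F : cellular_automaton F ->
  forall n x, iter n (@Defs.shift A) (F x) = F (iter n (@Defs.shift A) x).
Proof.
move=> [_ Fsh] n x; elim: n => //= n ->.
exact: esym (congr1 (fun G => G (iter n (@Defs.shift A) x)) Fsh).
Qed.

Lemma iter_iter_shift F : cellular_automaton F -> forall k n x,
  iter k F (iter n (@Defs.shift A) x) = iter n (@Defs.shift A) (iter k F x).
Proof. by move=> caF k n x; elim: k => //= k ->; rewrite (iter_shift_commute caF). Qed.

Lemma config_compact : finite_set [set: A] -> compact [set: config A].
Proof.
move=> finA; have cptA : compact [set: discrete_topology A] by exact: finite_compact.
have := @tychonoff int (fun=> discrete_topology A) (fun=> setT) (fun=> cptA).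
by congr (compact _); rewrite eqEsubset.
Qed.

(** Positions [p] are natural numbers because they are reached from 0 by iterating the shift; a
    [b]-periodic configuration is determined by its values on [0, b[. *)
Definition local_rule F (r : nat) := forall x y (p : nat),
  (forall j : int, p%:Z - r%:Z <= j <= p%:Z + r%:Z -> x j = y j) ->
  F x p%:Z = F y p%:Z.

(** Curtis-Hedlund-Lyndon: compactness makes the continuity of the coordinate 0 of [F] uniform, and
    commutation with the shift carries the radius to every [p]. *)
Lemma cellular_automaton_local F : finite_set [set: A] ->
  cellular_automaton F -> exists r, local_rule F r.
Proof.
move=> finA caF; have [cF _] := caF.
pose P (n : nat) x := forall y, cylinder n x y -> F x 0 = F y 0.
have : \forall n \near \oo, [set: config A] `<=` P n.
  have /compact_near_coveringP := config_compact finA; apply => x _.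
  have /nbhs_cylinder[n nx] : nbhs x (F @^-1` [set y | [set F x 0] (y 0)]).
    by apply: cF; apply: open_nbhs_nbhs; split=> //; exact: open_proj.
  exists (cylinder n x, [set k | (n <= k)%N]).
    by split; [exact: nbhs_cylinderxx|exists n].
  move=> [y k] /= [xy nk] y' yy'.
  rewrite (nx _ xy); apply/esym/(nx y') => j jn.
  by rewrite (cylinder_sub nk yy')// xy.
move=> [r _ /(_ r (leqnn r)) Pr]; exists r => x y p xy.
have := Pr (iter p (@Defs.shift A) x) I (iter p (@Defs.shift A) y).
rewrite -!(iter_shift_commute caF) !iter_shiftE !add0r; apply => j jr.
by rewrite !iter_shiftE xy//; lia.
Qed.

(** * Periodization between two equal walls *)

Definition periodize (b : nat) (x : config A) : config A :=
  fun p : int => x (p %% b%:Z)%Z.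

Lemma periodic_modz (b : nat) x (p : int) :
  (forall q : int, x (q + b%:Z) = x q) -> x p = x (p %% b%:Z)%Z.
Proof.
move=> xb; have xk (k : nat) (q : int) : x (q + k%:Z * b%:Z) = x q.
  elim: k => [|k IHk]; first by rewrite mul0r addr0.
  by rewrite -addn1 PoszD mulrDl mul1r addrA xb.
rewrite {1}(divz_eq p b%:Z) addrC; case: (p %/ b%:Z)%Z => k; first by rewrite xk.
(* The quotient is -(k+1), so adding k+1 periods to [p] gives the remainder. *)
rewrite NegzE -[LHS](xk k.+1); congr x; ring.
Qed.

(** Left of 0 the periodization reads the wall around [b], and from [b] on it reads the wall around
    0; both walls carry the same word. Since r < b, one translation by [b] is enough. *)
Lemma periodize_id (b r : nat) x : (r < b)%N ->
  (forall j : int, - r%:Z <= j <= r%:Z -> x (j + b%:Z) = x j) ->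
  forall j : int, - r%:Z <= j <= b%:Z + r%:Z -> periodize b x j = x j.
Proof.
move=> rb xb j jr; rewrite /periodize.
have [j0|j0] := ltP j 0.
  rewrite -modzDr modz_small; last lia.
  by rewrite xb//; lia.
have [jb|jb] := ltP j b%:Z; first by rewrite modz_small//; lia.
have -> : j = (j - b%:Z) + b%:Z by lia.
rewrite modzDr modz_small; last lia.
by rewrite xb//; lia.
Qed.

(** Both sides are [b]-periodic, so they are compared on [0, b[, where [F] only looks at coordinates
    in [-r, b + r]. *)
Lemma periodize_local_rule F (b r : nat) x : cellular_automaton F ->
  local_rule F r -> (0 < b)%N ->
  (forall j : int, - r%:Z <= j <= b%:Z + r%:Z -> periodize b x j = x j) ->
  F (periodize b x) = periodize b (F x).
Proof.
move=> caF Fr b0 xb; apply: funext => p.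
have Fb (q : int) : F (periodize b x) (q + b%:Z) = F (periodize b x) q.
  rewrite -iter_shiftE (iter_shift_commute caF); congr (F _ _); apply: funext => i.
  by rewrite iter_shiftE /periodize modzDr.
rewrite (periodic_modz _ Fb) {2}/periodize.
have [k kE kb] : exists2 k : nat, (p %% b%:Z)%Z = k%:Z & (k < b)%N.
  have bN0 : b%:Z != 0 by lia.
  have := modz_ge0 p bN0; have := ltz_pmod p (b0 : 0 < b%:Z).
  by case: (p %% b%:Z)%Z => // k kb _; exists k.
by rewrite kE; apply: Fr => j jk; apply: xb; lia.
Qed.

(* The two walls of width [r] isolate the word on [0, b[ from the outside, so
   that the periodization follows the same evolution as [x] on this window. *)
Lemma iter_periodize F (b r : nat) x : cellular_automaton F ->
  local_rule F r -> (r < b)%N ->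
  (forall t (j : int), - r%:Z <= j <= r%:Z ->
    iter t F x (j + b%:Z) = iter t F x j) ->
  forall t, iter t F (periodize b x) = periodize b (iter t F x).
Proof.
move=> caF Fr rb xb; elim=> // t IHt; rewrite /= IHt.
apply: (periodize_local_rule caF Fr (leq_ltn_trans (leq0n r) rb)).
by apply: periodize_id => // j; exact: xb.
Qed.

End cellular_automata.


(** * Borel sets of configurations and positivity of their measure *)

Section borel_sets.
Context {A : pointedType}.

Lemma open_borel (U : set (config A)) :
  open U -> measurable (U : set (borel_config A)).
Proof. by move=> oU; exact: sub_sigma_algebra. Qed.

Lemma closed_borel (C : set (config A)) :
  closed C -> measurable (C : set (borel_config A)).
Proof. by move=> /closed_openC/open_borel/measurableC; rewrite setCK. Qed.

Lemma continuous_borel (F : config A -> config A) : continuous F ->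
  measurable_fun [set: borel_config A] (F : borel_config A -> borel_config A).
Proof.
move=> /continuousP cF; apply: (@measurability _ _ (borel_config A)
  (borel_config A) setT F (@open (config A))) => //.
by move=> _ [U oU <-]; rewrite setTI; apply: open_borel; exact: cF.
Qed.

Lemma iter_continuous (F : config A -> config A) n :
  continuous F -> continuous (iter n F).
Proof.
move=> cF; elim: n => [|n IHn] x; first exact: cvg_id.
exact: (continuous_comp (IHn x) (cF _)).
Qed.

(** An intersection of closed sets over all times; this is what makes trace classes Borel. *)
Lemma closed_trace_class (F : config A -> config A) n x : continuous F ->
  closed (trace_class F n x).
Proof.
move=> cF; rewrite (_ : trace_class F n x = \bigcap_(i in [set: nat])
  (iter i F @^-1` cylinder n (iter i F x))).
  apply: closed_bigI => i _.
  by have /continuous_closedP := @iter_continuous F i cF; apply; exact: closed_cylinder.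
by rewrite predeqE => y; split=> xy i; [move=> _ j; exact: xy|exact: xy].
Qed.

(** Fixes the letters one by one: at each coordinate, one of the finitely many letters keeps the
    measure positive. A return to [W] then restores the whole word on [0, b[. *)
Lemma positive_word (R : realType) (mu : probability (borel_config A) R)
    (E : set (borel_config A)) (b : nat) :
  finite_set [set: A] -> measurable E -> (0 < mu E)%E ->
  exists W : set (borel_config A), [/\ measurable W, (0 < mu (E `&` W))%E &
    forall y z : config A, W y -> W z ->
      forall j : int, 0 <= j < b%:Z -> y j = z j].
Proof.
move=> finA mE E0; elim: b => [|b [W [mW EW0 Wb]]].
  by exists setT; split=> //; [rewrite setIT|move=> y z _ _ j; lia].
have mi (i : A) : measurable
    ((fun y : borel_config A => (y : config A) b%:Z) @^-1` [set i]).
  exact: open_borel (open_proj b%:Z [set i]).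
have [i Ei] := positive_fiber (finite_set_countable finA)
  (measurableI _ _ mE mW) mi EW0.
exists (W `&` ((fun y : borel_config A => (y : config A) b%:Z) @^-1` [set i])).
split; [exact: measurableI|by rewrite setIA|].
move=> y z [Wy /= yi] [Wz /= zi] j jb.
have [->|jNb] := eqVneq j b%:Z; first by rewrite yi zi.
by apply: Wb => //; lia.
Qed.

(** The complement of a null cylinder is closed of measure 1, so it would contain the support. *)
Lemma topological_support_cylinder (R : realType)
    (mu : probability (borel_config A) R) x n :
  topological_support mu x -> (0 < mu (cylinder n x))%E.
Proof.
move=> Sx; rewrite lt_neqAle measure_ge0 andbT; apply/eqP => C0.
have mC : measurable (cylinder n x : set (borel_config A)).
  exact: open_borel (open_cylinder n x).
have : (~` cylinder n x) x; last by apply; exact: cylinderxx.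
apply: Sx; split; first by apply: open_closedC; exact: open_cylinder.
by rewrite probability_setC// -C0 sube0.
Qed.

(** Ratios tending to 1 are eventually positive, whereas a null trace class would make all of them
    0. *)
Lemma equicontinuous_trace_class (R : realType)
    (mu : probability (borel_config A) R) (F : config A -> config A) x m :
  continuous F -> mu_equicontinuous mu F x -> (0 < mu (trace_class F m x))%E.
Proof.
move=> cF [_ /(_ m) limB].
have mB : measurable (trace_class F m x : set (borel_config A)).
  exact: closed_borel (closed_trace_class cF).
have [N _ /(_ N (leqnn N)) /=] := cvgr_gt (1 : R) limB _ ltr01.
apply: contraTT; rewrite -!leNgt measure_le0 => /eqP B0.
have -> : mu (cylinder N x `&` trace_class F m x) = 0%E.
  apply/eqP; rewrite -measure_le0 -B0; apply: le_measure; rewrite ?inE//.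
  by apply: measurableI => //; exact: open_borel (open_cylinder N x).
by rewrite mul0r.
Qed.

End borel_sets.

Theorem proposition5 (R : realType) (A : pointedType)
    (finA : finite_set [set: A]%classic)
    (F : config A -> config A) (mu : probability (borel_config A) R)
    (caF : cellular_automaton F)
    (invF : invariant_measure mu F)
    (ergmu : shift_ergodic mu)
    (eqF : exists x : config A, mu_equicontinuous mu F x) :
  dense_in (periodic_points F) (topological_support mu).
Proof.
move=> z Sz U /nbhs_cylinder[n zU]; have [cF _] := caF.
have [x eqx] := eqF; have [invs ergs] := ergmu.
have [r Fr] := cellular_automaton_local finA caF.
pose B : set (borel_config A) := trace_class F r x.
pose C : set (borel_config A) := cylinder n z.
have mB : measurable B := closed_borel (closed_trace_class cF).
have mC : measurable C := open_borel (open_cylinder n z).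
have msh := continuous_borel (@shift_continuous A).
have mF := continuous_borel cF.
have miter := measurable_preimage_iter msh.
have B0 : (0 < mu B)%E := equicontinuous_trace_class r cF eqx.
(* The bound n <= a puts the window [a - n, a + n] to the right of 0. *)
have [a na BC0] := ergodic_hits msh invs ergs n mB mC B0
  (topological_support_cylinder n Sz).
have mBC := measurableI _ _ mB (miter _ a mC).
(* The bound gives both a + n < b, so that this window lies in [0, b[, and r < b. *)
have [b nb E0] := ergodic_hits msh invs ergs (a + n + r).+1 mBC mB BC0 B0.
have mE := measurableI _ _ mBC (miter _ b mB).
have [W [mW EW0 Wb]] := positive_word b finA mE E0.
have [y [[[By Cy] /= Bby] Wy] [k [_ Wky]]] :=
  poincare_recurrence mF invF (measurableI _ _ mE mW) EW0.
have Fw : iter k.+1 F (periodize b y) = periodize b y.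
  rewrite (iter_periodize caF Fr); first last.
  (* Both [y] and its shift by [b] are in [B], so at each time both walls agree with the orbit of
     [x] on [-r, r]. *)
  - by move=> t j jr; rewrite -iter_shiftE -(iter_iter_shift caF) Bby// By.
  - by lia.
  (* Periodizations only read coordinates in [0, b[, where [y] and its return, both in [W],
     agree. *)
  apply: funext => p; rewrite /periodize; apply: Wb => //.
  by rewrite modz_ge0 ?ltz_pmod//; lia.
(* Shifting by [a] centers at 0 the copy of the word of [z] that [y] carries around [a]. *)
exists (iter a (@Defs.shift A) (periodize b y)); split.
  by exists k.+1; rewrite (iter_iter_shift caF) Fw.
apply: zU => j jn; rewrite iter_shiftE /periodize modz_small; last lia.
by rewrite -(Cy j jn) iter_shiftE.
Qed.
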